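(* Let $d\in\mathbb{N}$. A monotone digraph property $P=\bigcup_nP_n$ is $1$-sided error strongly-testable in the $FB(d)$-model if and only if for every $\epsilon>0$ there is $r=r(\epsilon)$ such that for every $n$ there is an $r$-set of digraphs $\mathcal{H}_n$ for which (a) $P_n\subseteq P_{\mathcal{H}_n}$ and (b) $P_{\mathcal{H}_n}$ is $\epsilon/2$-close to $P_n$, where $P_{\mathcal{H}_n}$ is the set of $n$-vertex digraphs of the $FB(d)$-model that are $\mathcal{H}_n$-free.
   Context: The $FB(d)$-model consists of all digraphs (no multiple edges, anti-parallel edges allowed) in which every vertex has in-degree and out-degree at most $d$. A query to an $n$-vertex digraph specifies a vertex $v$ and returns the pair $(\Gamma^+(v),\Gamma^-(v))$ of its out-neighbour and in-neighbour sets. A digraph property is a set of digraphs closed under isomorphism, $P_n$ its $n$-vertex members; it is monotone if closed under edge deletion. $G$ is $\mathcal{H}$-free if it has no subgraph isomorphic to a member of $\mathcal{H}$; an $r$-set is a set of digraphs each with at most $r$ vertices. For $n$-vertex digraphs of the model, $G$ is $\epsilon$-far from $G'$ if more than $\epsilon dn$ edge deletions/insertions are needed to turn $G$ into $G'$, otherwise $\epsilon$-close; $G$ is $\epsilon$-close to a set if close to some member; two sets are $\epsilon$-close if every member of each is $\epsilon$-close to the other. A $1$-sided error $\epsilon$-test for $P$ accepts every $n$-vertex digraph in $P$ with probability $1$ and rejects every $n$-vertex digraph $\epsilon$-far from $P_n$ with probability at least $1/2$; $P$ is $1$-sided error strongly-testable if for every $\epsilon\in(0,1)$ it has such a test whose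 number of queries is bounded by a function of $\epsilon$ only (independent of $n$). *)

(* Defs.v *)
From HB Require Import structures.
From mathcomp Require Import all_boot all_order all_algebra.
From mathcomp Require Import classical_sets reals.

Set Implicit Arguments.
Unset Strict Implicit.
Unset Printing Implicit Defensive.

Import Order.TTheory GRing.Theory Num.Theory.
Local Open Scope ring_scope.

(* Digraphs are loopless, as is usual when multiple edges are excluded. *)
Record digraph (n : nat) := Digraph {
  arcs : {set 'I_n * 'I_n};
  arcs_loopless : [forall v, (v, v) \notin arcs] }.

HB.instance Definition _ n := [isSub for @arcs n].
HB.instance Definition _ n := [Choice of digraph n by <:].
HB.instance Definition _ n := [Countable of digraph n by <:].
HB.instance Definition _ n := [Finite of digraph n by <:].

Definition out_nbrs n (G : digraph n) (v : 'I_n) : {set 'I_n} :=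
  finset (fun w => (v, w) \in arcs G).

Definition in_nbrs n (G : digraph n) (v : 'I_n) : {set 'I_n} :=
  finset (fun w => (w, v) \in arcs G).

Definition FB (d n : nat) : set (digraph n) :=
  fun G => forall v, (#|out_nbrs G v| <= d)%N /\ (#|in_nbrs G v| <= d)%N.

Definition isomorphic m n (G : digraph m) (G' : digraph n) : Prop :=
  exists f : 'I_m -> 'I_n, bijective f /\
    forall x y, ((x, y) \in arcs G) = ((f x, f y) \in arcs G').

(* [P n] is the set of n-vertex members of the property. *)
Definition digraph_property (d : nat) (P : forall n, set (digraph n)) : Prop :=
  (forall n, (P n `<=` FB d (n:=n))%classic) /\
  (forall n (G G' : digraph n), isomorphic G G' -> P n G -> P n G').

Definition monotone (P : forall n, set (digraph n)) : Prop :=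
  forall n (G G' : digraph n), arcs G' \subset arcs G -> P n G -> P n G'.

(* [F] is isomorphic to a (not necessarily induced) subgraph of [G]: the image
   of [F] under the vertex injection [f] is that subgraph. *)
Definition contains m n (F : digraph m) (G : digraph n) : Prop :=
  exists2 f : 'I_m -> 'I_n, injective f &
    forall x y, (x, y) \in arcs F -> (f x, f y) \in arcs G.

Definition any_digraph := {m : nat & digraph m}.

Definition r_set (r : nat) (H : set any_digraph) : Prop :=
  forall F, H F -> (tag F <= r)%N.

Definition free_digraphs (d n : nat) (H : set any_digraph) : set (digraph n) :=
  fun G => FB d G /\ forall F, H F -> ~ contains (tagged F) G.

(* The least number of arc deletions and insertions turning [G] into [G'] is
   the size of the symmetric difference of the arc sets. *)
Definition edit_dist n (G G' : digraph n) : nat :=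
  (#|arcs G :\: arcs G'| + #|arcs G' :\: arcs G|)%N.

Section Testing.
Variable R : realType.

Definition eps_far (d : nat) (eps : R) n (G G' : digraph n) : Prop :=
  eps * d%:R * n%:R < (edit_dist G G')%:R.

Definition eps_close (d : nat) (eps : R) n (G G' : digraph n) : Prop :=
  ~ eps_far d eps G G'.

Definition close_to_set (d : nat) (eps : R) n (G : digraph n)
    (Q : set (digraph n)) : Prop :=
  exists2 G', Q G' & eps_close d eps G G'.

Definition far_from_set (d : nat) (eps : R) n (G : digraph n)
    (Q : set (digraph n)) : Prop :=
  ~ close_to_set d eps G Q.

Definition close_sets (d : nat) (eps : R) n (Q Q' : set (digraph n)) : Prop :=
  (forall G, Q G -> close_to_set d eps G Q') /\
  (forall G, Q' G -> close_to_set d eps G Q).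

(* A deterministic adaptive query algorithm on n-vertex digraphs, as a decision
   tree; [Decide true] means accept. *)
Inductive query_alg (n : nat) :=
| Decide of bool
| Query (v : 'I_n) of ({set 'I_n} * {set 'I_n} -> query_alg n).

Fixpoint run n (A : query_alg n) (G : digraph n) : bool :=
  match A with
  | Decide b => b
  | Query v k => run (k (out_nbrs G v, in_nbrs G v)) G
  end.

Fixpoint num_queries n (A : query_alg n) (G : digraph n) : nat :=
  match A with
  | Decide _ => 0%N
  | Query v k => (num_queries (k (out_nbrs G v, in_nbrs G v)) G).+1
  end.

(* A randomized algorithm is a random choice of a deterministic one. A finite
   sample space loses nothing: with n and a query bound fixed, there are only
   finitely many decision trees up to the branches beyond the bound. *)
Record rand_alg (n : nat) := RandAlg {
  coins : finType;
  weight : coins -> R;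
  weight_ge0 : forall w, 0 <= weight w;
  weight_sum1 : \sum_w weight w = 1;
  alg : coins -> query_alg n }.

Definition pr_accept n (T : rand_alg n) (G : digraph n) : R :=
  \sum_(w | run (alg (r:=T) w) G) weight w.

Definition pr_reject n (T : rand_alg n) (G : digraph n) : R :=
  \sum_(w | ~~ run (alg (r:=T) w) G) weight w.

(* The algorithm may depend on n in an arbitrary way: only queries are counted,
   and no computability is required. *)
Definition one_sided_test (d : nat) (eps : R) (P : forall n, set (digraph n))
    (T : forall n, rand_alg n) : Prop :=
  (forall n (G : digraph n), P n G -> pr_accept (T n) G = 1) /\
  (forall n (G : digraph n), FB d G -> far_from_set d eps G (P n) ->
     2^-1 <= pr_reject (T n) G).

Definition queries_at_most (d q : nat) (T : forall n, rand_alg n) : Prop :=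
  forall n (G : digraph n) (w : coins (T n)), FB d G ->
    (num_queries (alg w) G <= q)%N.

Definition one_sided_strongly_testable (d : nat)
    (P : forall n, set (digraph n)) : Prop :=
  forall eps : R, 0 < eps < 1 ->
    exists q : nat, exists T : forall n, rand_alg n,
      one_sided_test d eps P T /\ queries_at_most d q T.

End Testing.

(* Main.v *)
(* Suppose P is testable with q queries and fix n.  Forbid every digraph on at
   most q(2d+1) vertices that no member of P_n contains.  A rejecting run on G
   only sees the arcs at q vertices; if the digraph they form were contained in
   some member of P_n, then, placed at its original position in G, it would
   itself lie in P_n by monotonicity and isomorphism invariance, yet it would be
   rejected with positive probability.

   Conversely, explore the balls of radius r around a constant number of random
   vertices, and accept iff some member of P_n contains all arcs that were seen.
   For a component of a forbidden digraph, rooted at c, call it rare in G if at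
   most n/D vertices of G are the image of c under an embedding of it.  Removing
   all arcs at images of rare roots costs at most (eps/2)dn, so if G is eps-far
   from P_n then the remaining digraph still contains a forbidden F, and no
   component of F is rare.  Hence, by a union bound, a large sample contains with
   probability at least 1/2 a root image for every component of F, and its balls
   are pairwise disjoint, so that the copies of the components assemble to a copy
   of F among the observed arcs. *)
Require Import Defs.
From mathcomp Require Import all_boot all_order all_algebra.
From mathcomp Require Import perm action primitive_action alt.
From mathcomp Require Import zify.
From mathcomp Require Import boolp classical_sets reals.

Import Order.TTheory GRing.Theory Num.Theory.
Local Open Scope ring_scope.

Set Implicit Arguments.
Unset Strict Implicit.
Unset Printing Implicit Defensive.

Local Open Scope nat_scope.

(** * Exploring balls *)

Lemma leq_card_bigcup (I T : finType) (Q : pred I) (F : I -> {set T}) :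
  #|(\bigcup_(i | Q i) F i)%SET| <= \sum_(i | Q i) #|F i|.
Proof.
elim/big_rec2: _ => [|i m X _ IH]; first by rewrite cards0.
by apply: leq_trans (leq_card_setU _ _) _; rewrite leq_add2l.
Qed.

Definition adj n (G : digraph n) : rel 'I_n :=
  fun u v => ((u, v) \in arcs G) || ((v, u) \in arcs G).

Lemma adj_sym n (G : digraph n) : symmetric (adj G).
Proof. by move=> u v; rewrite /adj orbC. Qed.

Lemma arcs_irr n (G : digraph n) v : (v, v) \in arcs G = false.
Proof. by have /forallP/(_ v)/negPf := arcs_loopless G. Qed.

Section Neighbourhoods.
Variable n : nat.
Implicit Types (G : digraph n) (S X : {set 'I_n}) (u v w : 'I_n).

Definition nbhd1 G u : {set 'I_n} := (u |: out_nbrs G u :|: in_nbrs G u)%SET.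

Definition nbhd G S : {set 'I_n} := (\bigcup_(u in S) nbhd1 G u)%SET.

Definition ball G k S : {set 'I_n} := iter k (nbhd G) S.

(** A query returns both neighbour sets, so these are exactly the arcs revealed by querying all of
    [X]. *)
Definition observed G X : {set 'I_n * 'I_n} :=
  finset (fun a => (a \in arcs G) && ((a.1 \in X) || (a.2 \in X))).

Lemma in_nbhd1 G u v : (v \in nbhd1 G u) = (v == u) || adj G u v.
Proof. by rewrite /nbhd1 !inE orbA. Qed.

Lemma nbhd1_sym G u v : (v \in nbhd1 G u) = (u \in nbhd1 G v).
Proof. by rewrite !in_nbhd1 eq_sym adj_sym. Qed.

Lemma nbhdP G S v :
  reflect (exists2 u, u \in S & v \in nbhd1 G u) (v \in nbhd G S).
Proof. exact: bigcupP. Qed.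

Lemma card_nbhd1 d G u : FB d G -> #|nbhd1 G u| <= d.*2.+1.
Proof.
move=> /(_ u)[oG iG]; apply: leq_trans (leq_card_setU _ _) _.
have [U _] := leq_card_setU [set u]%SET (out_nbrs G u).
apply: leq_trans (leq_add U iG) _.
by rewrite cards1 -addnn addSn !ltnS leq_add2r.
Qed.

Lemma card_nbhd d G S : FB d G -> #|nbhd G S| <= #|S| * d.*2.+1.
Proof.
move=> FBG; rewrite -sum_nat_const.
apply: leq_trans (leq_card_bigcup _ _) _.
by apply: leq_sum => u _; apply: card_nbhd1.
Qed.

Lemma card_ball d G k S : FB d G -> #|ball G k S| <= #|S| * d.*2.+1 ^ k.
Proof.
move=> FBG; elim: k => [|k IH]; first by rewrite muln1.
apply: leq_trans (card_nbhd _ FBG) _.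
by rewrite expnSr mulnA leq_mul2r IH orbT.
Qed.

Lemma sub_nbhd G S : S \subset nbhd G S.
Proof. by apply/fintype.subsetP=> u uS; apply/nbhdP; exists u; rewrite // in_nbhd1 eqxx. Qed.

Lemma nbhdS G S X : S \subset X -> nbhd G S \subset nbhd G X.
Proof.
move=> /fintype.subsetP SX; apply/fintype.subsetP=> v /nbhdP[u uS uv].
by apply/nbhdP; exists u => //; apply: SX.
Qed.

Lemma ballS G k S X : S \subset X -> ball G k S \subset ball G k X.
Proof. by move=> SX; elim: k => //= k IH; apply: nbhdS. Qed.

Lemma ballSr G k S : ball G k.+1 S = ball G k (nbhd G S).
Proof. exact: iterSr. Qed.

Lemma ball_leq G k l S : k <= l -> ball G k S \subset ball G l S.
Proof.
move=> /subnK <-; elim: (l - k) => //= j IH.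
exact: fintype.subset_trans IH (sub_nbhd _ _).
Qed.

Lemma ball1_sym G k u v : (v \in ball G k [set u]) = (u \in ball G k [set v]).
Proof.
suff sym a b : a \in ball G k [set b] -> b \in ball G k [set a].
  by apply/idP/idP; apply: sym.
elim: k a b => [|k IH] a b; first by rewrite !inE eq_sym.
move=> /nbhdP[w wb wa]; have {wb} := IH _ _ wb.
rewrite /ball iterSr => bw; apply: fintype.subsetP bw; apply: ballS.
by rewrite finset.sub1set; apply/nbhdP; exists a; [rewrite inE | rewrite nbhd1_sym].
Qed.

(** Used in contrapositive: centres at distance more than [2k] have disjoint balls of radius [k]. *)
Lemma ball_meet G k u v w :
  w \in ball G k [set u] -> w \in ball G k [set v] ->
  v \in ball G (k + k) [set u].
Proof.
move=> wu; rewrite ball1_sym => vw; rewrite /ball iterD.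
by apply: fintype.subsetP vw; apply: ballS; rewrite finset.sub1set.
Qed.

Lemma observedS G X : observed G X \subset arcs G.
Proof. by apply/fintype.subsetP=> a; rewrite inE => /andP[]. Qed.

(** The next layer depends on the query answers alone, which lets [explore] grow its set without
    access to [G]. *)
Lemma nbhd_observed G S :
  nbhd G S = (S :|: finset (fun v => [exists u, ((u, v) \in observed G S)
                                            || ((v, u) \in observed G S)]))%SET.
Proof.
apply/setP=> v; rewrite !inE; apply/nbhdP/orP.
  case=> u uS; rewrite in_nbhd1 => /orP[/eqP->|uv]; first by left.
  by right; apply/existsP; exists u; rewrite !inE /= uS orbT !andbT.
case=> [vS|/existsP[u]]; first by exists v; rewrite // in_nbhd1 eqxx.
rewrite !inE /= [_ || (u \in S)]orbC -andb_orl => /andP[uv /orP[uS|vS]].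
  by exists u; rewrite // in_nbhd1 /adj uv orbT.
by exists v; rewrite // in_nbhd1 eqxx.
Qed.

End Neighbourhoods.

Section Exploration.
Variable n : nat.
Implicit Types (G : digraph n) (S : {set 'I_n}) (O : {set 'I_n * 'I_n}).

Fixpoint query_seq (L : seq 'I_n) O (cont : {set 'I_n * 'I_n} -> query_alg n) :=
  if L is v :: L' then
    Query v (fun ans => query_seq L'
      (O :|: finset (fun a => (a.1 == v) && (a.2 \in ans.1)
                           || (a.2 == v) && (a.1 \in ans.2)))%SET cont)
  else cont O.

(** Every round queries the whole current set afresh. This costs a factor [k + 1] in queries, but
    the last round alone then yields all arcs at the final ball. *)
Fixpoint explore (accept : {set 'I_n * 'I_n} -> bool) k S : query_alg n :=
  query_seq (enum S) finset.set0 (fun O =>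
    if k is k'.+1 then
      explore accept k' (S :|: finset (fun v =>
        [exists u, ((u, v) \in O) || ((v, u) \in O)]))%SET
    else Decide n (accept O)).

Lemma query_step G O v L :
  (O :|: finset (fun a => (a.1 == v) && (a.2 \in out_nbrs G v)
                       || (a.2 == v) && (a.1 \in in_nbrs G v))
     :|: observed G (finset (mem L)) =
   O :|: observed G (finset (mem (v :: L))))%SET.
Proof.
apply/setP=> -[a b]; rewrite !inE /=.
case: eqP => [->|_]; case: eqP => [->|_] //=;
  rewrite ?andbF ?andbT ?orbF ?orbT //; do ?[case: (_ \in arcs G); rewrite //= ?orbT ?orbF].
Qed.

Lemma run_query_seq G L O cont :
  run (query_seq L O cont) G = run (cont (O :|: observed G (finset (mem L)))%SET) G.
Proof.
elim: L O => [|v L IH] O /=; last by rewrite IH query_step.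
congr (run (cont _) G); apply/setP=> a; rewrite !inE andbF orbF //.
Qed.

Lemma num_queries_query_seq G L O cont :
  num_queries (query_seq L O cont) G =
  size L + num_queries (cont (O :|: observed G (finset (mem L)))%SET) G.
Proof.
elim: L O => [|v L IH] O /=; last by rewrite IH query_step addSn.
congr (num_queries (cont _) G); apply/setP=> a; rewrite !inE andbF orbF //.
Qed.

Lemma run_explore accept k S G :
  run (explore accept k S) G = accept (observed G (ball G k S)).
Proof.
elim: k S => [|k IH] S /=; rewrite run_query_seq finset.set0U set_enum //.
by rewrite IH -nbhd_observed {1}/ball -iterSr.
Qed.

Lemma num_queries_explore d accept k S G : FB d G ->
  num_queries (explore accept k S) G <= k.+1 * (#|S| * d.*2.+1 ^ k).
Proof.
move=> FBG; elim: k S => [|k IH] S /=;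
  rewrite num_queries_query_seq finset.set0U set_enum -cardE.
  by rewrite addn0 muln1 mul1n.
rewrite -nbhd_observed mulSn leq_add ?leq_pmulr ?expn_gt0 //.
apply: leq_trans (IH _) _; rewrite leq_mul2l /= expnS mulnA leq_mul2r.
by rewrite card_nbhd ?orbT.
Qed.

End Exploration.

(** * Testers yield forbidden patterns *)

(** The symmetric group is [m]-transitive on [T] for every [m <= #|T|], so some permutation carries
    the tuple of [e] to that of [f]. *)
Lemma perm_extend (T : finType) m (e f : 'I_m -> T) :
  injective e -> injective f -> exists s : {perm T}, forall i, s (e i) = f i.
Proof.
move=> inje injf.
have lemT : m <= #|T| by rewrite -[m]card_ord; apply: leq_card inje.
have dt (g : 'I_m -> T) : injective g -> mktuple g \in (m.-dtuple([set: T]))%SET.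
  move=> injg; apply/dtuple_onP; split=> [i j|i]; last by rewrite inE.
  by rewrite !tnth_mktuple => /injg.
have tr := ntransitive_weak lemT (Sym_trans T).
have [s _ def] := atransP2 tr (dt e inje) (dt f injf).
exists s => i; rewrite -(tnth_mktuple f) def /= tnth_map tnth_mktuple.
by rewrite /= /aperm.
Qed.

Section Traces.
Variable n : nat.
Implicit Types (A : query_alg n) (G : digraph n).

Fixpoint queried A G : seq 'I_n :=
  if A is Query v k then v :: queried (k (out_nbrs G v, in_nbrs G v)) G
  else [::].

Lemma size_queried A G : size (queried A G) = num_queries A G.
Proof. by elim: A => //= v k IH; rewrite IH. Qed.

Lemma run_agree A G G' :
  {in queried A G, forall v,
    out_nbrs G' v = out_nbrs G v /\ in_nbrs G' v = in_nbrs G v} ->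
  run A G' = run A G.
Proof.
elim: A => //= v k IH agr.
have [-> ->] := agr v (mem_head _ _).
by apply: IH => w wq; apply: agr; rewrite inE wq orbT.
Qed.

Lemma observed_loopless G X : [forall v, (v, v) \notin observed G X].
Proof. by apply/forallP=> v; rewrite inE arcs_irr. Qed.

Definition observed_graph G X := Digraph (observed_loopless G X).

Lemma run_observed_graph A G (X : {set 'I_n}) : {subset queried A G <= X} ->
  run A (observed_graph G X) = run A G.
Proof.
move=> qX; apply: run_agree => v /qX vX.
by split; apply/setP=> w; rewrite !inE /= vX ?orbT ?andbT.
Qed.

End Traces.

Definition relabel n (s : {perm 'I_n}) (G : digraph n) : {set 'I_n * 'I_n} :=
  finset (fun a => (s^-1 a.1, s^-1 a.2)%g \in arcs G).

Lemma relabel_loopless n (s : {perm 'I_n}) G : [forall v, (v, v) \notin relabel s G].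
Proof. by apply/forallP=> v; rewrite inE arcs_irr. Qed.

Definition relabel_graph n (s : {perm 'I_n}) (G : digraph n) :=
  Digraph (relabel_loopless s G).

Lemma relabel_isomorphic n (s : {perm 'I_n}) (G : digraph n) :
  isomorphic (relabel_graph s G) G.
Proof.
exists (s^-1)%g; split=> [|x y]; last by rewrite inE.
by exists s => x; rewrite ?permK ?permKV.
Qed.

Section InducedPattern.
Variables (n : nat) (G : digraph n) (S : {set 'I_n}).

(** Renumbering [S] through [enum_val] makes the order of the pattern [#|S|], as an [r]-set has to
    bound it. *)
Definition induced_arcs : {set 'I_#|S| * 'I_#|S|} :=
  finset (fun a => (enum_val a.1, enum_val a.2) \in arcs G).

Lemma induced_loopless : [forall v, (v, v) \notin induced_arcs].
Proof. by apply/forallP=> v; rewrite inE arcs_irr. Qed.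

Definition induced_graph := Digraph induced_loopless.

Lemma contains_induced : contains induced_graph G.
Proof. by exists enum_val => [|x y]; [apply: enum_val_inj | rewrite inE]. Qed.

End InducedPattern.

(** Extending the embedding of [S] to a permutation of all vertices moves [G] isomorphically onto a
    subgraph of [G'], because [G] has no arc leaving [S]. *)
Lemma pattern_in_property d (P : forall n, set (digraph n)) n (G G' : digraph n)
    (S : {set 'I_n}) :
  digraph_property d P -> monotone P -> P n G' ->
  (forall u v, (u, v) \in arcs G -> u \in S /\ v \in S) ->
  contains (induced_graph G S) G' -> P n G.
Proof.
move=> [_ isoP] monoP PG' GS [f injf fG'].
have [s sE] := perm_extend (@enum_val_inj _ (mem S)) injf.
apply: (isoP _ _ _ (relabel_isomorphic s G)); apply: monoP PG'.
apply/fintype.subsetP=> -[x y]; rewrite inE /= => xy.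
have [xS yS] := GS _ _ xy.
(* The vertex [s^-1 x] lies in [S], where [s] agrees with [f] up to the numbering of [S]. *)
have -> : x = f (enum_rank_in xS (s^-1 x))%g.
  by rewrite -sE enum_rankK_in // permKV.
have -> : y = f (enum_rank_in yS (s^-1 y))%g.
  by rewrite -sE enum_rankK_in // permKV.
by apply: fG'; rewrite inE /= !enum_rankK_in.
Qed.

Local Open Scope ring_scope.

Lemma pr_accept_reject (R : realType) n (T : rand_alg R n) G :
  pr_accept T G + pr_reject T G = 1.
Proof. by rewrite -(weight_sum1 T) (bigID (fun w => run (alg w) G)). Qed.

Lemma close_refl (R : realType) d (eps : R) n (G : digraph n) :
  0 <= eps -> eps_close d eps G G.
Proof.
move=> eps0; rewrite /eps_close /eps_far /edit_dist finset.setDv cards0.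
by apply/negP; rewrite -leNgt !mulr_ge0.
Qed.

Lemma testable_forbidden (R : realType) d (P : forall n, set (digraph n)) :
  digraph_property d P -> monotone P ->
  one_sided_strongly_testable R d P ->
  forall eps : R, 0 < eps ->
    exists r : nat, forall n : nat, exists H : set any_digraph,
      [/\ r_set r H,
          (P n `<=` @free_digraphs d n H)%classic &
          close_sets d (eps / 2) (@free_digraphs d n H) (P n)].
Proof.
move=> propP monoP testP eps eps0.
(* Testers exist only for parameters below 1, while [eps] is arbitrary here. *)
pose e := Num.min (eps / 2) (2^-1).
have e2 : e <= eps / 2 by rewrite /e ge_min lexx.
have e01 : 0 < e < 1.
  by rewrite lt_min gt_min divr_gt0 ?invr_gt0 ?invf_lt1 ?ltr1n ?ltr0n ?orbT.
have [q [T [[accT rejT] qT]]] := testP e e01.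
(* At most [q] queried vertices, each with at most [2d] neighbours. *)
exists (q * d.*2.+1)%N => n.
exists (fun F => (tag F <= q * d.*2.+1)%N /\
                 forall G', P n G' -> ~ contains (tagged F) G').
have PF : (P n `<=` @free_digraphs d n (fun F => (tag F <= q * d.*2.+1)%N /\
                 forall G', P n G' -> ~ contains (tagged F) G'))%classic.
  move=> G PG; split; first exact: (propP.1 n G PG).
  by move=> F [_]; apply.
split=> [F []//|//|]; split=> G GP; last first.
  by exists G; [exact: PF | apply: close_refl; rewrite divr_ge0 // ltW].
have [FBG freeG] := GP.
have [[G' PG' clG']|farG] := pselect (close_to_set d e G (P n)).
  exists G' => // far; apply: clG'; apply: le_lt_trans far.
  by rewrite ler_wpM2r ?ler0n // ler_wpM2r ?ler0n.
have rej := rejT n G FBG farG.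
(* A positive rejection probability needs a rejecting outcome of nonzero weight. *)
have [w wrej w0] : exists2 w : coins (T n), ~~ run (alg w) G & weight w != 0.
  apply: contrapT => nw; suff z : pr_reject (T n) G = 0.
    by move: rej; rewrite z invr_le0 lern0.
  apply: big1 => w wrej; apply/eqP; apply: contrapT => /negP w0.
  by apply: nw; exists w.
pose Q := finset (mem (queried (alg w) G)).
pose O := observed_graph G Q; pose S := nbhd G Q.
have cS : (#|S| <= q * d.*2.+1)%N.
  apply: leq_trans (card_nbhd _ FBG) _; rewrite leq_mul2r; apply/orP; right.
  by rewrite cardsE; apply: leq_trans (card_size _) _; rewrite size_queried qT.
(* If no member of [P n] contains the pattern, it is forbidden, yet [G] contains it. *)
have [[G' PG' cont]|nP] :=
  pselect (exists2 G', P n G' & contains (induced_graph O S) G'); last first.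
  exfalso; apply: (freeG (Tagged digraph (induced_graph O S))).
    by split=> // G' PG' cont; apply: nP; exists G'.
  have [f injf fO] := contains_induced O S; exists f => // x y xy.
  by have := fO _ _ xy; rewrite inE => /andP[].
have PO : P n O.
  apply: (pattern_in_property propP monoP PG' _ cont) => u v.
  rewrite inE /= => /andP[uv /orP[uQ|vQ]]; split.
  - exact: fintype.subsetP (sub_nbhd G Q) _ uQ.
  - by apply/nbhdP; exists u; rewrite // in_nbhd1 /adj uv orbT.
  - by apply/nbhdP; exists v; rewrite // in_nbhd1 /adj uv !orbT.
  - exact: fintype.subsetP (sub_nbhd G Q) _ vQ.
have runO : ~~ run (alg w) O.
  by rewrite run_observed_graph // => v; rewrite inE.
have /eqP : pr_reject (T n) O = 0.
  by apply: (addrI (pr_accept (T n) O)); rewrite pr_accept_reject addr0 (accT n O PO).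
rewrite psumr_eq0; last by move=> i _; exact: weight_ge0.
by move/allP/(_ w (mem_index_enum w)); rewrite runO (negPf w0).
Qed.

Local Open Scope nat_scope.

(** * Rare and frequent rooted components *)

Section Hosting.

(* [phi] only has to embed the component of [c] in [F]; its values elsewhere are
   irrelevant. *)
Definition hosts m n (F : digraph m) (c : 'I_m) (G : digraph n) (phi : 'I_m -> 'I_n) :=
  {in connect (adj F) c &, injective phi} /\
  forall x y, connect (adj F) c x -> (x, y) \in arcs F -> (phi x, phi y) \in arcs G.

Definition host_set m n (F : digraph m) (c : 'I_m) (G : digraph n) : {set 'I_n} :=
  finset (fun v => `[< exists2 phi, hosts F c G phi & phi c = v >]).

Lemma adj_connect_sym m (F : digraph m) : connect_sym (adj F).
Proof. exact/sym_connect_sym/adj_sym. Qed.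

Variables (m n : nat) (F : digraph m) (G : digraph n).

(** A simple path from [c] has at most [m] vertices, and [phi] maps it to a walk of the same length
    in [G]. *)
Lemma hosts_ball c phi r x : hosts F c G phi -> m <= r ->
  connect (adj F) c x -> phi x \in ball G r [set phi c]%SET.
Proof.
move=> [_ phiF] mr /connectP[p pth ->].
case/shortenP: pth => {}p pth up _.
have sp : size p <= r.
  apply: leq_trans mr; have := card_uniqP up; rewrite /= => cp.
  by apply: ltnW; rewrite -cp -[leqRHS]card_ord max_card.
apply: fintype.subsetP (ball_leq _ _ sp) _ _.
(* The start of the path is generalised but kept in the component of [c], the only place where [phi]
   must preserve arcs. *)
have: connect (adj F) c c by exact: connect0.
move: pth; move: {1 3 4 5}c => a; elim: p a {up sp} => [|b p IH] a.
  by rewrite inE.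
rewrite [path _ _ _]/= => /andP[ab pb] ca; have cb := connect_trans ca (connect1 ab).
have phiab : adj G (phi a) (phi b).
  by apply/orP; case/orP: ab => arc; [left | right]; exact: phiF arc.
rewrite ballSr.
apply: fintype.subsetP (IH b pb cb); apply: ballS.
by rewrite finset.sub1set; apply/nbhdP; exists (phi a); [rewrite inE | rewrite in_nbhd1 phiab orbT].
Qed.

Lemma hosts_contains c phi : injective phi ->
  (forall x y, (x, y) \in arcs F -> (phi x, phi y) \in arcs G) -> hosts F c G phi.
Proof. by move=> inj phiF; split=> [x y _ _|x y _]; [apply: inj | apply: phiF]. Qed.

(** Isolated roots need separate care: removing all arcs at a vertex does not stop it from hosting
    one. *)
Lemma host_set_isolated c : (forall y, ~~ adj F c y) -> host_set F c G = [set: 'I_n]%SET.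
Proof.
move=> iso; apply/setP=> v; rewrite !inE; apply/asboolP.
have comp x : connect (adj F) c x -> x = c.
  by move=> /connectP[[|b p] /= + ->] //; rewrite (negPf (iso b)).
exists (fun=> v) => //; split=> [x y /comp -> /comp -> //|x y /comp -> cy].
by have := iso y; rewrite /adj cy.
Qed.

(** Each vertex is mapped by the embedding chosen for the canonical root of its component. Arcs stay
    inside components, and images of different components lie in disjoint balls, which gives
    injectivity. *)
Lemma reassemble (r : nat) (X : {set 'I_n}) (g : 'I_m -> 'I_n) : m <= r ->
  (forall c, g c \in X) -> (forall c, g c \in host_set F c G) ->
  (forall c c' w, w \in ball G r [set g c]%SET -> w \in ball G r [set g c']%SET -> c = c') ->
  exists2 h : 'I_m -> 'I_n, injective h &
    forall x y, (x, y) \in arcs F -> (h x, h y) \in observed G (ball G r X).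
Proof.
move=> mr gX hostg apart.
have /boolp.choice[phi phiP] c : exists phi, hosts F c G phi /\ phi c = g c.
  by have := hostg c; rewrite inE => /asboolP[phi]; exists phi.
pose rt := fingraph.root (adj F).
have rtC x : connect (adj F) (rt x) x by rewrite adj_connect_sym connect_root.
have inball x : phi (rt x) x \in ball G r [set g (rt x)]%SET.
  by have [hp <-] := phiP (rt x); apply: hosts_ball.
exists (fun x => phi (rt x) x) => [x y e|x y xy].
  have rxy : rt x = rt y by apply: apart (inball x) _; rewrite e.
  by have [[inj _] _] := phiP (rt x); apply: inj;
    [exact: rtC | rewrite rxy; exact: rtC | rewrite e rxy].
have rxy : rt y = rt x.
  by apply/(fingraph.rootP (@adj_connect_sym _ F))/connect1; rewrite /adj xy orbT.
rewrite inE rxy; have [[_ phiF] _] := phiP (rt x).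
rewrite (phiF _ _ (rtC x) xy) /=.
apply/orP; left; apply: fintype.subsetP (inball x); apply: ballS.
by rewrite finset.sub1set.
Qed.

End Hosting.

Section Pruning.
Variables (n : nat) (G : digraph n).

Definition pruned_arcs (B : {set 'I_n}) := (arcs G :\: observed G B)%SET.

Lemma pruned_loopless B : [forall v, (v, v) \notin pruned_arcs B].
Proof. by apply/forallP=> v; rewrite inE arcs_irr andbF. Qed.

Definition pruned B := Digraph (pruned_loopless B).

Lemma pruned_sub B : arcs (pruned B) \subset arcs G.
Proof. exact: subsetDl. Qed.

Lemma in_pruned B x y :
  (x, y) \in arcs (pruned B) = [&& x \notin B, y \notin B & (x, y) \in arcs G].
Proof. by rewrite !inE /= negb_and negb_or; case: (_ \in arcs G); rewrite ?andbF ?andbT. Qed.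

Lemma edit_dist_pruned B : edit_dist G (pruned B) = #|observed G B|.
Proof.
rewrite /edit_dist /= /pruned_arcs finset.setDDr finset.setDv finset.set0U.
rewrite finset.setDDl finset.setUC -finset.setDDl finset.setDv finset.set0D cards0 addn0.
by congr #|pred_of_set _|; apply/finset.setIidPr/observedS.
Qed.

Lemma card_observed d B : FB d G -> #|observed G B| <= #|B| * d.*2.
Proof.
move=> FBG.
have sub : observed G B \subset (\bigcup_(u in B)
   ((fun w => (u, w)) @: out_nbrs G u :|: (fun w => (w, u)) @: in_nbrs G u))%SET.
  apply/fintype.subsetP=> -[x y]; rewrite inE /= => /andP[xy /orP[xB|yB]].
    by apply/finset.bigcupP; exists x => //; rewrite inE imset_f // inE.
  by apply/finset.bigcupP; exists y => //; rewrite inE orbC imset_f // inE.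
apply: leq_trans (subset_leq_card sub) _; rewrite -sum_nat_const.
apply: leq_trans (leq_card_bigcup _ _) _; apply: leq_sum => u _.
apply: leq_trans (leq_card_setU _ _) _; rewrite -addnn.
by have [oG iG] := FBG u; apply: leq_add; apply: leq_trans (leq_imset_card _ _) _.
Qed.

End Pruning.

(** A finite type of rooted digraphs of order at most [r], so the number of patterns depends on [r]
    only. *)
Definition pattern r := {m : 'I_r.+1 & (digraph m * 'I_m)%type}.

Section Rare.
Variables (r n D : nat) (G : digraph n).

Definition pattern_hosts (p : pattern r) : {set 'I_n} :=
  host_set (tagged p).1 (tagged p).2 G.

(** All patterns are treated, not just those from the forbidden family, so that the bound is uniform
    in families varying with [n]. *)
Definition rare_vertices : {set 'I_n} :=
  (\bigcup_(p : pattern r | D * #|pattern_hosts p| <= n) pattern_hosts p)%SET.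

Lemma card_rare_vertices : D * #|rare_vertices| <= #|{: pattern r}| * n.
Proof.
apply: (@leq_trans (\sum_(p : pattern r | D * #|pattern_hosts p| <= n) n)); last first.
  by rewrite sum_nat_const leq_mul2r max_card orbT.
apply: leq_trans (leq_mul (leqnn D) (leq_card_bigcup _ _)) _.
by rewrite big_distrr; apply: leq_sum.
Qed.

(** A rare root would be mapped into [rare_vertices], where no arc survives pruning; this is
    impossible if [c] has a neighbour. An isolated [c] is hosted by all [n] vertices, and
    [n < D * n]. *)
Lemma pruned_frequent m (F : digraph m) (c : 'I_m) : 1 < D -> m <= r ->
  contains F (pruned G rare_vertices) -> n < D * #|host_set F c G|.
Proof.
move=> D1 mr [f injf fF]; rewrite ltnNge; apply/negP=> rare.
have [/existsP[y cy]|/existsPn iso] := boolP [exists y, adj F c y]; last first.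
  move: rare; rewrite host_set_isolated // cardsT card_ord.
  have n_gt0 : 0 < n by apply: leq_ltn_trans (ltn_ord (f c)).
  by rewrite leqNgt ltn_Pmull.
have fc : f c \in rare_vertices.
  apply/finset.bigcupP; exists (existT _ (Ordinal (mr : m < r.+1)) (F, c) : pattern r) => //.
  rewrite inE; apply/asboolP; exists f => //; apply: hosts_contains => // x z xz.
  exact: fintype.subsetP (pruned_sub _ _) _ (fF _ _ xz).
by case/orP: cy => /fF; rewrite in_pruned fc ?andbF.
Qed.

End Rare.

(** * Random samples *)

(** Bernoulli's inequality [(1 + 1/a)^t >= 1 + t/a] with denominators cleared; [t = k * a] makes the
    right side [k + 1]. *)
Lemma bernoulli_ratio k a : 0 < a -> exists t, k * a ^ t <= a.+1 ^ t.
Proof.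
move=> a_gt0.
have bern t : (a + t) * a ^ t <= a * a.+1 ^ t.
  elim: t => [|t IH]; first by rewrite addn0 !muln1.
  rewrite !expnS mulnA [leqRHS]mulnCA; apply: leq_trans (leq_mul (leqnn _) IH).
  by rewrite mulnA leq_mul2r; apply/orP; right; nia.
exists (k * a); have := bern (k * a).
rewrite -[X in (X + _)%N]mul1n -mulnDl add1n [k.+1 * a]mulnC -mulnA leq_pmul2l //.
by apply: leq_trans; rewrite leq_mul2r leqnSn orbT.
Qed.

Section Sampling.
Variables (J : finType) (n : nat).
Implicit Types (x : {ffun J -> 'I_n}) (F : J -> {set 'I_n}).

Lemma card_samples F :
  #|finset (fun x => [forall i, x i \in F i])| = \prod_i #|F i|.
Proof.
rewrite cardsE (eq_card (B := family (fun i => mem (F i)))); last first.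
  by move=> x; rewrite !inE; apply/forallP/familyP.
by rewrite card_family foldrE big_map big_enum.
Qed.

(** With denominators cleared: [#|S|] independent uniform coordinates all avoid [A] with probability
    [(1 - #|A|/n)^#|S|]. *)
Lemma card_avoid (S : {set J}) (A : {set 'I_n}) :
  #|finset (fun x => [forall i in S, x i \notin A])| * n ^ #|S| =
  (n - #|A|) ^ #|S| * n ^ #|J|.
Proof.
have -> : finset (fun x => [forall i in S, x i \notin A]) =
    finset (fun x => [forall i, x i \in if i \in S then ~: A else [set: 'I_n]])%SET.
  apply/setP=> x; rewrite !inE; apply: eq_forallb => i.
  by case: (i \in S); rewrite !inE.
have <- : #|~: A|%SET = n - #|A| by rewrite cardsCs card_ord finset.setCK.
rewrite card_samples (bigID (mem S)) /=.
rewrite (eq_bigr (fun=> #|~: A|%SET)); last by by move=> i ->.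
rewrite [X in _ * X * _](eq_bigr (fun=> n)); last by move=> i /negPf ->; rewrite cardsT card_ord.
rewrite !prod_nat_const -mulnA -expnD; congr (_ * n ^ _).
by rewrite addnC -(cardC (mem S)).
Qed.

(** Conditioned on the value [u] of [x i], the independent coordinate [x j] falls into [N u] with
    probability at most [M/n]. *)
Lemma card_collide (i j : J) (N : 'I_n -> {set 'I_n}) M : i != j ->
  (forall u, #|N u| <= M) ->
  #|finset (fun x => x j \in N (x i))| * n <= M * n ^ #|J|.
Proof.
move=> ij NM; have [n0|n_gt0] := posnP n.
  by apply: (@leq_trans 0); rewrite // leqn0 muln_eq0 (introT eqP n0) orbT.
rewrite -(leq_pmul2r n_gt0) -mulnA.
pose E u := finset (fun x => (x i == u) && (x j \in N u)).
have cE u : #|E u| * (n * n) <= M * n ^ #|J|.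
  have -> : E u = finset (fun x => [forall k, x k \in
      if k == i then [set u] else if k == j then N u else [set: 'I_n]])%SET.
    apply/setP=> x; rewrite !inE; apply/andP/forallP => [[/eqP xi xj] k|xF].
      by case: eqP => [->|_]; [rewrite inE xi | case: eqP => [->|_]; rewrite ?inE].
    by have := xF i; have := xF j; rewrite !eqxx eq_sym (negPf ij) inE.
  rewrite card_samples (bigD1 i) //= (bigD1 j) /=; last by rewrite eq_sym.
  rewrite !eqxx eq_sym (negPf ij) cards1 mul1n.
  rewrite [X in _ * X * _](eq_bigr (fun=> n)); last first.
    by move=> k /andP[/negPf -> /negPf ->]; rewrite cardsT card_ord.
  rewrite prod_nat_const -mulnA leq_mul // mulnn -expnD leq_pexp2l //.
  rewrite (cardD1 i J) (cardD1 j [predD1 J & i]) !inE eq_sym ij /= addn2 !ltnS.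
  by apply: subset_leq_card; apply/fintype.subsetP=> k; rewrite !inE => /andP[ki kj]; rewrite ki kj.
apply: (@leq_trans (\sum_(u < n) M * n ^ #|J|)); last by rewrite sum_nat_const card_ord mulnC.
apply: (@leq_trans (\sum_(u < n) #|E u| * (n * n))); last exact: leq_sum.
rewrite -big_distrl leq_mul2r /=; apply/orP; right.
rewrite -sum1_card (partition_big (fun x => x i) predT) //=.
apply: leq_sum => u _; rewrite -sum1_card; apply/eq_leq/eq_bigl => x.
by rewrite !inE andbC; case: eqP => // ->.
Qed.

End Sampling.

Section GoodSamples.
Variables (d n r t D m : nat) (G : digraph n) (F : digraph m).
Local Notation J := ('I_r * 'I_t)%type.
Implicit Type x : {ffun J -> 'I_n}.

(* The samples are grouped in [r] blocks of [t], so that distinct components of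
   [F] use distinct samples. *)
Definition good_sample x := `[< exists2 h : 'I_m -> 'I_n, injective h &
  forall u v, (u, v) \in arcs F ->
    (h u, h v) \in observed G (ball G r (x @: [set: J])%SET) >].

Definition block (c : 'I_r) : {set J} := finset (fun i => i.1 == c).

Lemma card_block c : #|block c| = t.
Proof.
have -> : block c = finset.setX [set c]%SET [set: 'I_t]%SET.
  by apply/setP=> i; rewrite !inE andbT.
by rewrite cardsX cards1 cardsT card_ord mul1n.
Qed.

Definition missing c (A : {set 'I_n}) : {set {ffun J -> 'I_n}} :=
  finset (fun x => [forall i in block c, x i \notin A]).

Definition colliding (p : J * J) : {set {ffun J -> 'I_n}} :=
  finset (fun x => x p.2 \in ball G (r + r) [set x p.1]%SET).

Hypotheses (mr : m <= r) (FBG : FB d G).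

Lemma good_sampleP x :
  (forall c : 'I_m, x \notin missing (widen_ord mr c) (host_set F c G)) ->
  (forall p, p.1 != p.2 -> x \notin colliding p) -> good_sample x.
Proof.
move=> hit apart; apply/asboolP.
have /boolp.choice[i iP] (c : 'I_m) : exists i, i.1 = widen_ord mr c /\ x i \in host_set F c G.
  have := hit c; rewrite inE negb_forall => /existsP[i].
  by rewrite negb_imply negbK inE => /andP[/eqP ? ?]; exists i.
apply: (reassemble (g := fun c => x (i c)) mr) => [c|c|c c' w wc wc'].
- by rewrite imset_f // inE.
- by have [] := iP c.
- have [ii|ii] := eqVneq (i c) (i c').
    have [e _] := iP c; have [e' _] := iP c'; apply/ord_inj.
    by rewrite -[LHS](congr1 (@nat_of_ord _) e) ii e'.
  by have := apart (i c, i c') ii; rewrite inE (ball_meet wc wc').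
Qed.

(** A block of [t] samples misses a set of density at least [1/D] with probability at most
    [(1 - 1/D)^t], hence at most [1/k]. *)
Lemma card_missing c (A : {set 'I_n}) k : 0 < n -> k * D.-1 ^ t <= D ^ t ->
  n <= D * #|A| -> k * #|missing c A| <= n ^ #|{: J}|.
Proof.
move=> n_gt0 kD nA; have D_gt0 : 0 < D by case: D nA => // /(leq_trans n_gt0).
have := card_avoid (block c) A; rewrite card_block => cA.
have An : #|A| <= n by rewrite -[leqRHS]card_ord max_card.
have le : D ^ t * (n - #|A|) ^ t <= D.-1 ^ t * n ^ t.
  have [->//|t_gt0] := posnP t.
  by rewrite -!expnMn leq_exp2r // mulnBr -subn1 mulnBl mul1n leq_sub2l.
rewrite -(@leq_pmul2r (D ^ t * n ^ t)) ?muln_gt0 ?expn_gt0 ?D_gt0 ?n_gt0 //.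
rewrite [X in X <= _](_ : _ = k * (D ^ t * (n - #|A|) ^ t) * n ^ #|{: J}|); last first.
  by rewrite mulnACA cA !mulnA.
rewrite [leqRHS]mulnC leq_mul2r; apply/orP; right.
by apply: leq_trans (leq_mul (leqnn k) le) _; rewrite mulnA leq_mul2r kD orbT.
Qed.

Lemma card_colliding p : p.1 != p.2 ->
  #|colliding p| * n <= d.*2.+1 ^ (r + r) * n ^ #|{: J}|.
Proof.
move=> neq; apply: (card_collide (N := fun u => ball G (r + r) [set u]%SET)) => // u.
by have := card_ball (r + r) [set u]%SET FBG; rewrite cards1 mul1n.
Qed.

(** Union bound: the at most [r] roots are missed with total probability at most [1/4], and so are
    the collisions over all pairs of indices. At least half of the samples remain. *)
Lemma card_good_samples : 0 < n ->
  4 * r.+1 * D.-1 ^ t <= D ^ t ->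
  4 * #|{: J * J}| * d.*2.+1 ^ (r + r) <= n ->
  (forall c, n < D * #|host_set F c G|) ->
  n ^ #|{: J}| <= 2 * #|finset good_sample|.
Proof.
move=> n_gt0 Dt n_large frequent; set N := n ^ _.
pose miss := (\bigcup_(c : 'I_m) missing (widen_ord mr c) (host_set F c G))%SET.
pose coll := (\bigcup_(p : J * J | p.1 != p.2) colliding p)%SET.
have cover : [set: {ffun J -> 'I_n}]%SET \subset (finset good_sample :|: miss :|: coll)%SET.
  apply/fintype.subsetP=> x _; rewrite !inE.
  have [|nmiss] := boolP (x \in miss); first by rewrite orbT.
  have [|ncoll] := boolP (x \in coll); rewrite ?orbT //= !orbF.
  apply: good_sampleP => [c|p np].
    by apply: contra nmiss => ?; apply/finset.bigcupP; exists c.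
  by apply: contra ncoll => ?; apply/finset.bigcupP; exists p.
have cN : N <= #|finset good_sample| + #|miss| + #|coll|.
  have := subset_leq_card cover; rewrite cardsT card_ffun card_ord => /leq_trans; apply.
  apply: leq_trans (leq_card_setU _ _) _; rewrite leq_add2r.
  exact: leq_card_setU.
have missN : 4 * #|miss| <= N.
  rewrite -(leq_pmul2l (ltn0Sn r)) mulnA [_ * 4]mulnC.
  apply: leq_trans (leq_mul (leqnn _) (leq_card_bigcup _ _)) _; rewrite big_distrr /=.
  apply: (@leq_trans (\sum_(c < m) N)).
    by apply: leq_sum => c _; apply: card_missing => //; apply: ltnW.
  by rewrite sum_nat_const card_ord leq_mul2r (leq_trans mr) ?orbT.
have collN : 4 * #|coll| <= N.
  rewrite -(leq_pmul2r n_gt0) [leqRHS]mulnC.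
  apply: leq_trans (leq_mul n_large (leqnn _)).
  rewrite -!mulnA leq_mul2l /=.
  apply: leq_trans (leq_mul (leq_card_bigcup _ _) (leqnn _)) _; rewrite big_distrl /=.
  apply: (@leq_trans (\sum_(p : J * J | p.1 != p.2) d.*2.+1 ^ (r + r) * N)).
    by apply: leq_sum => p; apply: card_colliding.
  by rewrite sum_nat_const leq_mul2r max_card orbT.
lia.
Qed.

End GoodSamples.

Local Open Scope ring_scope.

(** * Forbidden patterns yield a tester *)

Section UniformAlgorithm.
Variables (R : realType) (n : nat) (C : finType) (C_gt0 : (0 < #|C|)%N).
Variable A : C -> query_alg n.

Lemma uniform_sum1 : \sum_(w : C) (#|C|%:R^-1 : R) = 1.
Proof. by rewrite sumr_const -[LHS]mulr_natl divff // pnatr_eq0 -lt0n. Qed.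

Definition uniform_alg : rand_alg R n :=
  @RandAlg R n C (fun=> #|C|%:R^-1) (fun=> ltac:(by rewrite invr_ge0)) uniform_sum1 A.

Lemma pr_reject_uniform (Q : {set C}) (G : digraph n) :
  (forall w, w \in Q -> ~~ run (A w) G) -> (#|C| <= 2 * #|Q|)%N ->
  2^-1 <= pr_reject uniform_alg G.
Proof.
move=> rejQ CQ; apply: (@le_trans _ _ (\sum_(w in Q) (#|C|%:R^-1 : R))).
  rewrite sumr_const -[leRHS]mulr_natl ler_pdivlMr ?ltr0n //.
  by rewrite mulrC ler_pdivrMr ?ltr0n // mulrC -natrM ler_nat.
rewrite /pr_reject big_mkcond [leRHS]big_mkcond /=; apply: ler_sum => w _.
by case: ifPn => [/rejQ ->//|_]; case: ifP => // _; rewrite invr_ge0.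
Qed.

Lemma pr_accept_uniform (G : digraph n) :
  (forall w, run (A w) G) -> pr_accept uniform_alg G = 1.
Proof.
by move=> acc; rewrite -uniform_sum1; apply: eq_bigl => w; rewrite acc.
Qed.

End UniformAlgorithm.

Lemma FB_sub d n (G G' : digraph n) : arcs G' \subset arcs G -> FB d G -> FB d G'.
Proof.
move=> /fintype.subsetP sub FBG v; have [oG iG] := FBG v.
by split; [apply: leq_trans oG | apply: leq_trans iG];
   apply: subset_leq_card; apply/fintype.subsetP=> w; rewrite !inE; apply: sub.
Qed.

Lemma edit_dist_triangle n (G1 G2 G3 : digraph n) :
  (edit_dist G1 G3 <= edit_dist G1 G2 + edit_dist G2 G3)%N.
Proof.
have tri (X Y Z : {set 'I_n * 'I_n}) : (#|X :\: Z| <= #|X :\: Y| + #|Y :\: Z|)%N.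
  apply: leq_trans (leq_card_setU _ _); apply: subset_leq_card.
  apply/fintype.subsetP=> a; rewrite !inE; case: (a \in Y); rewrite ?orbT ?orbF.
    by move=> /andP[-> _].
  by move=> /andP[_ ->].
rewrite /edit_dist.
have := tri (arcs G1) (arcs G2) (arcs G3); have := tri (arcs G3) (arcs G2) (arcs G1).
lia.
Qed.

Definition consistent (P : forall n, set (digraph n)) n (O : {set 'I_n * 'I_n}) : bool :=
  `[< exists2 G', P n G' & O \subset arcs G' >].

Lemma consistent_observed (P : forall n, set (digraph n)) n (G : digraph n) X :
  P n G -> consistent P (observed G X).
Proof. by move=> PG; apply/asboolP; exists G => //; exact: observedS. Qed.

Section Tester.
Variables (R : realType) (d : nat) (P : forall n, set (digraph n)).
Arguments P : clear implicits.
Variables (r t D E n : nat) (H : set any_digraph) (eps : R).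
Local Notation K := #|{: pattern r}|.

Hypothesis eps_gt0 : 0 < eps.
Hypothesis epsE : 1 <= eps * E%:R.
(** There are at most [K * n / D] rare vertices with at most [2d] arcs each, so pruning removes at
    most [d * n / (2 * E)] arcs, which is at most [(eps/2) * d * n]. *)
Hypothesis DE : D = (4 * K.+1 * E)%N.
Hypothesis Hr : r_set r H.
Hypothesis closeH : close_sets d (eps / 2) (@free_digraphs d n H) (P n).
Hypothesis subH : (P n `<=` @free_digraphs d n H)%classic.

(** Otherwise the pruned digraph is free, hence [eps/2]-close to [P n]; pruning costs another
    [eps/2], and the triangle inequality contradicts farness. *)
Lemma far_pruned_contains (G : digraph n) : FB d G -> far_from_set d eps G (P n) ->
  exists2 F : any_digraph, H F & contains (tagged F) (pruned G (rare_vertices r D G)).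
Proof.
set B := rare_vertices r D G => FBG farG; apply: contrapT => nocopy.
have freeG1 : free_digraphs d H (pruned G B).
  split=> [|F HF cF]; first exact: FB_sub (pruned_sub _ _) FBG.
  by apply: nocopy; exists F.
have [G2 PG2 cl2] := closeH.1 _ freeG1.
apply: farG; exists G2 => // far; apply: cl2; rewrite /eps_far in far *.
have few : (edit_dist G (pruned G B))%:R <= eps / 2 * d%:R * n%:R.
  rewrite edit_dist_pruned; set o := #|_|.
  have oB : (o <= #|B| * d.*2)%N by exact: card_observed.
  have rB : (D * #|B| <= K * n)%N by exact: card_rare_vertices.
  have oE : (2 * E * o <= d * n)%N.
    have : (D * o <= K * n * d.*2)%N.
      by apply: leq_trans (leq_mul (leqnn D) oB) _; rewrite mulnA leq_mul2r rB orbT.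
    (* Multiplying by [2 * K.+1] turns the left side into [D * o]. *)
    rewrite DE => h; rewrite -(@leq_pmul2l (2 * K.+1)) //.
    rewrite (_ : _ * (_ * _) = 4 * K.+1 * E * o)%N; last by move: K => K; nia.
    by apply: leq_trans h _; move: K => K; rewrite -muln2; nia.
  have oER : 2 * E%:R * o%:R <= (d * n)%:R :> R by rewrite -natrM -natrM ler_nat.
  have step : eps / 2 * (2 * E%:R * o%:R) <= eps / 2 * (d * n)%:R.
    by rewrite ler_wpM2l // divr_ge0 // ltW.
  rewrite -mulrA -natrM; apply: le_trans step.
  have -> : eps / 2 * (2 * E%:R * o%:R) = eps * E%:R * o%:R.
    by rewrite !mulrA -[eps / 2 * 2]mulrA mulVf ?mulr1 // pnatr_eq0.
  by rewrite ler_peMl.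
have tri : (edit_dist G G2)%:R <=
    (edit_dist G (pruned G B))%:R + (edit_dist (pruned G B) G2)%:R :> R.
  by rewrite -natrD ler_nat edit_dist_triangle.
have := lt_le_trans far tri.
rewrite -ltrBlDl; apply: le_lt_trans; rewrite lerBrDr.
by apply: le_trans (lerD (lexx _) few) _; rewrite -2!mulrDl -splitr.
Qed.

Lemma reject_copy (G : digraph n) (F : any_digraph) X :
  H F -> (exists2 h : 'I_(tag F) -> 'I_n, injective h &
    forall u v, (u, v) \in arcs (tagged F) -> (h u, h v) \in observed G X) ->
  ~~ consistent P (observed G X).
Proof.
move=> HF [h injh hF]; apply/asboolP=> -[G' PG' /fintype.subsetP sub].
have [_ /(_ F HF)] := subH PG'; apply; exists h => // u v /hF; exact: sub.
Qed.

Definition sample_tester (x : {ffun 'I_r * 'I_t -> 'I_n}) : query_alg n :=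
  explore (consistent P (n := n)) r (x @: [set: 'I_r * 'I_t])%SET.

Lemma sample_tester_rejects (G : digraph n) : FB d G -> far_from_set d eps G (P n) ->
  (0 < n)%N -> (1 < D)%N -> (4 * r.+1 * D.-1 ^ t <= D ^ t)%N ->
  (4 * #|{: ('I_r * 'I_t) * ('I_r * 'I_t)}| * d.*2.+1 ^ (r + r) <= n)%N ->
  exists2 Q : {set {ffun 'I_r * 'I_t -> 'I_n}},
    forall x, x \in Q -> ~~ run (sample_tester x) G &
    (n ^ #|{: 'I_r * 'I_t}| <= 2 * #|Q|)%N.
Proof.
move=> FBG farG n_gt0 D_gt1 Dt n_large.
have [F HF cF] := far_pruned_contains FBG farG.
exists (finset (@good_sample n r t _ G (tagged F))) => [x|].
  by rewrite inE run_explore => /asboolP; exact: reject_copy.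
apply: (card_good_samples (Hr HF) FBG n_gt0 Dt n_large) => c.
exact: pruned_frequent (Hr HF) cF.
Qed.

(** For [n <= M], which includes [n = 0], all vertices are queried; sampling is used only when [n]
    is large enough to make collisions unlikely. In both cases the exploration starts from at most
    [M] plus the sample size many vertices. *)
Lemma tester_exists q : (1 < D)%N -> (4 * r.+1 * D.-1 ^ t <= D ^ t)%N ->
  monotone P ->
  let M := (4 * #|{: ('I_r * 'I_t) * ('I_r * 'I_t)}| * d.*2.+1 ^ (r + r))%N in
  (r.+1 * ((M + #|{: 'I_r * 'I_t}|) * d.*2.+1 ^ r) <= q)%N ->
  exists T : rand_alg R n,
    [/\ forall G, P n G -> pr_accept T G = 1,
        forall G, FB d G -> far_from_set d eps G (P n) -> 2^-1 <= pr_reject T G &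
        forall G (w : coins T), FB d G -> (num_queries (alg w) G <= q)%N].
Proof.
move=> D_gt1 Dt monoP M Mq.
have queries (S : {set 'I_n}) G : FB d G -> (#|S| <= M + #|{: 'I_r * 'I_t}|)%N ->
    (num_queries (explore (consistent P (n := n)) r S) G <= q)%N.
  move=> FBG cS; apply: leq_trans (num_queries_explore _ _ _ FBG) (leq_trans _ Mq).
  by rewrite leq_mul2l leq_mul2r cS !orbT.
have [nM|nM] := leqP n M.
  have C_gt0 : (0 < #|{: unit}|)%N by rewrite card_unit.
  exists (uniform_alg R C_gt0 (fun=> explore (consistent P (n := n)) r [set: 'I_n]%SET)).
  split=> [G PG|G FBG farG|G w FBG];
    last by apply: queries; rewrite // cardsT card_ord (leq_trans nM) ?leq_addr.
    by apply: pr_accept_uniform => _; rewrite run_explore consistent_observed.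
  apply: (@pr_reject_uniform _ _ _ _ _ [set: unit]%SET); last by rewrite cardsT card_unit.
  (* Here every arc of [G] is observed, so consistency would put [G] itself into [P n] by
     monotonicity. *)
  move=> _ _; rewrite run_explore; apply/asboolP=> -[G' PG' sub]; apply: farG; exists G.
    apply: monoP PG'; apply: fintype.subset_trans sub; apply/fintype.subsetP=> a aG.
    rewrite inE aG; apply/orP; left.
    by apply: fintype.subsetP (ball_leq _ _ (leq0n r)) _ _; rewrite inE.
  by apply: close_refl; apply: ltW.
have n_gt0 : (0 < n)%N by apply: leq_ltn_trans nM.
have C_gt0 : (0 < #|{: {ffun 'I_r * 'I_t -> 'I_n}}|)%N.
  by rewrite card_ffun card_ord expn_gt0 n_gt0.
exists (uniform_alg R C_gt0 sample_tester); split=> [G PG|G FBG farG|G w FBG].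
- by apply: pr_accept_uniform => x; rewrite run_explore consistent_observed.
- have [Q rejQ cQ] := sample_tester_rejects FBG farG n_gt0 D_gt1 Dt (ltnW nM).
  by apply: pr_reject_uniform rejQ _; rewrite card_ffun card_ord.
- apply: queries => //; apply: leq_trans (leq_imset_card _ _) _.
  by rewrite cardsT leq_addl.
Qed.

End Tester.

Theorem theorem6p3 (R : realType) (d : nat) (P : forall n : nat, set (digraph n))
    (propP : digraph_property d P) (monoP : monotone P) :
  one_sided_strongly_testable R d P <->
  (forall eps : R, 0 < eps ->
    exists r : nat, forall n : nat, exists H : set any_digraph,
      [/\ r_set r H,
          (P n `<=` @free_digraphs d n H)%classic &
          close_sets d (eps / 2) (@free_digraphs d n H) (P n)]).
Proof.
split=> [|forbid eps /andP[eps_gt0 _]]; first exact: testable_forbidden.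
have [r Hr] := forbid eps eps_gt0.
pose E := (Num.trunc eps^-1).+1.
have epsE : 1 <= eps * E%:R.
  by rewrite -ler_pdivrMl // mulr1 ltW // truncnS_gt.
pose D := (4 * #|{: pattern r}|.+1 * E)%N.
have D_gt1 : (1 < D)%N by rewrite /D; lia.
(* The block length that brings the chance of missing a frequent root below [1 / (4 * r.+1)]. *)
have [t Dt] : exists t, (4 * r.+1 * D.-1 ^ t <= D ^ t)%N.
  have [|t] := @bernoulli_ratio (4 * r.+1)%N D.-1; first by rewrite -subn1 subn_gt0.
  by rewrite prednK ?(ltnW D_gt1) //; exists t.
have tester n := let: ex_intro H (And3 H1 H2 H3) := Hr n in
  tester_exists eps_gt0 epsE (erefl D) H1 H3 H2 D_gt1 Dt monoP (leqnn _).
exists (r.+1 * ((4 * #|{: ('I_r * 'I_t) * ('I_r * 'I_t)}| * d.*2.+1 ^ (r + r) +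
  #|{: 'I_r * 'I_t}|) * d.*2.+1 ^ r))%N.
(* Choice gathers the testers for the separate [n] into a family; [r], [t] and [D] are fixed before
   [n], so one query bound serves all. *)
exists (fun n => sval (cid (tester n))).
split; first split; move=> n; have [accT rejT qT] := svalP (cid (tester n)).
- exact: accT.
- exact: rejT.
- exact: qT.
Qed.
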